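(* Let $X$ be a Cantor set and let $\mathcal{G}\subset\mathrm{Homeo}(X)$ be an ample group that acts minimally on $X$ and has Property E. Suppose $U\subset X$ is a clopen set different from the empty set and $X$. Then $\mathrm{St}_{\mathcal{G}}(U,X\setminus U)$, the stabilizer of the partition $X=U\sqcup(X\setminus U)$, is a maximal subgroup of $\mathcal{G}$. If $U$ cannot be mapped onto $X\setminus U$ by an element of $\mathcal{G}$, then $\mathrm{St}_{\mathcal{G}}(U)=\mathrm{St}_{\mathcal{G}}(U,X\setminus U)$; otherwise $\mathrm{St}_{\mathcal{G}}(U)$ is a subgroup of index $2$ in $\mathrm{St}_{\mathcal{G}}(U,X\setminus U)$.
   Context: $\mathrm{Homeo}(X)$ is the group of all homeomorphisms of $X$. For a group $G\subset\mathrm{Homeo}(X)$, its full amplification $\mathsf{F}(G)$ is the group of all homeomorphisms $f$ of $X$ such that every point $x\in X$ has an open neighborhood $U_x$ on which $f$ coincides with some element of $G$. The group $G$ is called ample if $\mathsf{F}(G)=G$. A group acts minimally on $X$ if the only closed invariant subsets are $\emptyset$ and $X$. For a clopen (closed and open) set $U\subset X$, the local subgroup $\mathcal{G}_U$ consists of all $g\in\mathcal{G}$ such that $g(x)=x$ for all $x\notin U$. Property E for the ample group $\mathcal{G}$: for any clopen sets $U_1,U_2\subset X$ with $U_1\cap U_2\ne\emptyset$, the group $\mathcal{G}_{U_1\cup U_2}$ is generated by $\mathcal{G}_{U_1}\cup\mathcal{G}_{U_2}$. $\mathrm{St}_{\mathcal{G}}(U)=\{g\in\mathcal{G}\mid g(U)=U\}$.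 For a collection of distinct sets $Y_1,\dots,Y_k\subset X$, $\mathrm{St}_{\mathcal{G}}(Y_1,\dots,Y_k)$ consists of those $g\in\mathcal{G}$ that map each set of the collection onto a (the same or another) set of the collection. A maximal subgroup of $\mathcal{G}$ is a proper subgroup $H$ such that there is no subgroup $K$ with $H\subsetneq K\subsetneq\mathcal{G}$. *)

(* Defs.v *)
From HB Require Import structures.
From mathcomp Require Import all_boot all_classical.
From mathcomp Require Import topology cantor.

Set Implicit Arguments.
Unset Strict Implicit.
Unset Printing Implicit Defensive.

Local Open Scope classical_set_scope.
Local Open Scope group_scope.

Definition is_subgroup (gT : groupType) (H : set gT) : Prop :=
  group_closed (mem H).

Definition generated (gT : groupType) (S : set gT) : set gT :=
  smallest (@is_subgroup gT) S.

Definition maximal_subgroup (gT : groupType) (G H : set gT) : Prop :=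
  [/\ is_subgroup H, H `<` G &
      ~ exists K : set gT, [/\ is_subgroup K, H `<` K & K `<` G]].

Definition left_cosets (gT : groupType) (K H : set gT) : set (set gT) :=
  [set [set k * h | h in H] | k in K].

Definition subgroup_of_index (gT : groupType) (n : nat) (K H : set gT) : Prop :=
  [/\ is_subgroup K, is_subgroup H, H `<=` K &
      (left_cosets K H #= `I_n)%card].

Definition homeomorphic (X Y : topologicalType) : Prop :=
  exists (f : X -> Y) (g : Y -> X),
    [/\ continuous f, continuous g, cancel f g & cancel g f].

(* [cantor_like] of the library is not used because, on a mere topological
   space, it requires neither metrizability nor nonemptiness. *)
Definition cantor_set (X : topologicalType) : Prop :=
  homeomorphic X cantor_space.

Record homeo (X : topologicalType) := Homeo {
  homeo_fun :> X -> X;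
  homeo_inv : X -> X;
  homeo_fun_continuous : continuous homeo_fun;
  homeo_inv_continuous : continuous homeo_inv;
  homeo_funK : cancel homeo_fun homeo_inv;
  homeo_invK : cancel homeo_inv homeo_fun }.

Section HomeoGroup.
Variable X : topologicalType.
Implicit Types f g h : homeo X.

Lemma homeo_ext f g : f =1 g -> f = g.
Proof.
case: f g => [f f' cf cf' fK f'K] [g g' cg cg' gK g'K] /= /funext fg.
have fg' : f' = g' by apply/funext => x; rewrite -{1}(g'K x) -fg fK.
case: _ / fg in cg gK g'K *; case: _ / fg' in cg' gK g'K *.
by congr Homeo; exact: Prop_irrelevance.
Qed.

Definition homeo_one : homeo X :=
  @Homeo X id id (fun x => @cvg_id _ (nbhs x)) (fun x => @cvg_id _ (nbhs x))
    (fun=> erefl) (fun=> erefl).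

(* Unlike for [{perm T}], the product is [(f * g) x = f (g x)]. *)
Definition homeo_mul f g : homeo X :=
  @Homeo X (f \o g) (homeo_inv g \o homeo_inv f)
    (fun x => continuous_comp (@homeo_fun_continuous _ g x)
                              (@homeo_fun_continuous _ f (g x)))
    (fun x => continuous_comp (@homeo_inv_continuous _ f x)
                              (@homeo_inv_continuous _ g (homeo_inv f x)))
    (can_comp (@homeo_funK _ f) (@homeo_funK _ g))
    (can_comp (@homeo_invK _ g) (@homeo_invK _ f)).

Definition homeo_invg f : homeo X :=
  @Homeo X (homeo_inv f) f (@homeo_inv_continuous _ f)
    (@homeo_fun_continuous _ f) (@homeo_invK _ f) (@homeo_funK _ f).

HB.instance Definition _ := gen_eqMixin (homeo X).
HB.instance Definition _ := gen_choiceMixin (homeo X).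

Fact homeo_mulA : associative homeo_mul.
Proof. by move=> f g h; exact: homeo_ext. Qed.

Fact homeo_mul1 : left_id homeo_one homeo_mul.
Proof. by move=> f; exact: homeo_ext. Qed.

Fact homeo_mulr1 : right_id homeo_one homeo_mul.
Proof. by move=> f; exact: homeo_ext. Qed.

Fact homeo_mulV : left_inverse homeo_one homeo_invg homeo_mul.
Proof. by move=> f; apply: homeo_ext => x /=; rewrite homeo_funK. Qed.

Fact homeo_mulrV : right_inverse homeo_one homeo_invg homeo_mul.
Proof. by move=> f; apply: homeo_ext => x /=; rewrite homeo_invK. Qed.

HB.instance Definition _ := isGroup.Build (homeo X)
  homeo_mulA homeo_mul1 homeo_mulr1 homeo_mulV homeo_mulrV.

End HomeoGroup.

Section Ample.
Variable X : topologicalType.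
Implicit Types (G : set (homeo X)) (U : set X).

Definition full_amplification G : set (homeo X) :=
  [set f | forall x, exists2 U, open_nbhs x U &
             exists2 g, G g & forall y, U y -> f y = g y].

Definition ample G : Prop := full_amplification G = G.

Definition acts_minimally G : Prop :=
  forall C : set X, closed C -> (forall g, G g -> g @` C `<=` C) ->
    C = set0 \/ C = setT.

Definition local_subgroup G U : set (homeo X) :=
  [set g | G g /\ forall x, ~ U x -> g x = x].

Definition property_E G : Prop :=
  forall U1 U2, clopen U1 -> clopen U2 -> U1 `&` U2 !=set0 ->
    generated (local_subgroup G U1 `|` local_subgroup G U2) =
    local_subgroup G (U1 `|` U2).

Definition stabilizer G U : set (homeo X) := [set g | G g /\ g @` U = U].

(* [Y] is a set of sets, so its members are automatically distinct; the theory
   only uses finite [Y], for which mapping members to members is the same as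
   permuting them. *)
Definition stabilizer_collection G (Y : set (set X)) : set (homeo X) :=
  [set g | G g /\ forall A, Y A -> Y (g @` A)].

End Ample.

(* Main.v *)
(** If [g] does not preserve the partition [X = U + ~U], then [g U] or [g (~U)]
    meets both [U] and [~U].  A subgroup containing the stabilizer of the
    partition and [g] contains the local subgroups of [U], [~U], [g U] and
    [g (~U)], and two applications of Property E make it everything.  The
    stabilizer is proper: if [A] is a proper nonempty clopen part of [U],
    Property E generates [G] by the local subgroups of [U] and [~U + A]; the
    latter fix a point of [U], so if they preserved the partition they would
    preserve [U], against minimality. *)
Require Import Defs.
From mathcomp Require Import all_boot all_classical.
From mathcomp Require Import topology cantor.

Local Open Scope classical_set_scope.

(** * Subgroups given as sets; cosets and index two *)

Section Subgroups.
Local Open Scope group_scope.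
Context {gT : groupType}.
Implicit Types (H K S : set gT) (x y : gT).

(** Trades the boolean [mem H] of [group_closed] for plain application of [H]. *)
Lemma is_subgroupP H :
  is_subgroup H <-> H 1 /\ forall x y, H x -> H y -> H (x * y^-1).
Proof.
split=> -[H1 HD]; split; first by move/set_mem: H1.
- by move=> x y /mem_set Hx /mem_set Hy; exact/set_mem/(HD x y).
- exact: mem_set.
- by move=> x y /set_mem Hx /set_mem Hy; exact/mem_set/HD.
Qed.

Lemma is_subgroup1 H : is_subgroup H -> H 1.
Proof. by case/is_subgroupP. Qed.

Lemma is_subgroupV H x : is_subgroup H -> H x -> H x^-1.
Proof. by case/is_subgroupP => H1 HD Hx; rewrite -[x^-1]mul1g; exact: HD. Qed.

Lemma is_subgroupM H x y : is_subgroup H -> H x -> H y -> H (x * y).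
Proof.
move=> sH Hx Hy; rewrite -[y]invgK.
by case/is_subgroupP: (sH) => _; apply => //; exact: is_subgroupV.
Qed.

Lemma generated_sub S H : is_subgroup H -> S `<=` H -> generated S `<=` H.
Proof. by move=> sH SH; exact: smallest_sub. Qed.

Lemma left_coset_id H x : is_subgroup H -> H x -> [set x * h | h in H] = H.
Proof.
move=> sH Hx; apply/seteqP; split=> [_ [h Hh <-]|h Hh].
  exact: is_subgroupM.
exists (x^-1 * h); last by rewrite mulVKg.
by apply: is_subgroupM => //; exact: is_subgroupV.
Qed.

Lemma subgroup_of_index2 K H x :
  is_subgroup K -> is_subgroup H -> H `<=` K -> K x -> ~ H x ->
  (forall y, K y -> H y \/ H (x^-1 * y)) -> subgroup_of_index 2 K H.
Proof.
move=> sK sH HK Kx nHx Kcov; split => //.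
(* [F] numbers the two cosets; only its values at 0 and 1 matter. *)
pose F n : set gT := if n is 0%N then H else [set x * h | h in H].
have -> : left_cosets K H = F @` `I_2.
  apply/seteqP; split=> [_ [y Ky <-]|_ [[|[|//]] _ <-]].
  - case: (Kcov y Ky) => Hy; first by exists 0%N; rewrite ?left_coset_id.
    (* Here [y H = x (x^-1 y) H = x H], since [x^-1 * y] lies in [H]. *)
    exists 1%N => //=; rewrite -[in LHS](left_coset_id _ _ sH Hy).
    by rewrite image_comp; apply: eq_imagel => h _ /=; rewrite mulgA mulVKg.
  - by exists 1; rewrite ?left_coset_id//; exact: is_subgroup1.
  - by exists x.
apply: inj_card_eq.
have HxH : H <> [set x * h | h in H].
  move=> E; apply: nHx; rewrite E.
  by exists 1; [exact: is_subgroup1|rewrite mulg1].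
by move=> [|[|i]] [|[|j]] /set_mem // _ /set_mem //= _ E; case: HxH.
Qed.

End Subgroups.

(** * Images under homeomorphisms, local subgroups and stabilizers *)

Section Homeomorphisms.
Local Open Scope group_scope.
Context {X : topologicalType}.
Implicit Types (f g : homeo X) (A B U : set X) (G K : set (homeo X)).

(** Preimages commute with complements and preserve clopen sets under continuous maps; this carries
    both facts over to images. *)
Lemma homeo_imageE f A : f @` A = homeo_inv f @^-1` A.
Proof.
apply/seteqP; split=> [_ [x Ax <-]|x Ax]; first by rewrite /= homeo_funK.
by exists (homeo_inv f x) => //=; rewrite homeo_invK.
Qed.

Lemma homeo_imageC f A : f @` (~` A) = ~` (f @` A).
Proof. by rewrite !homeo_imageE. Qed.

Lemma homeo_imageM f g A : (f * g) @` A = f @` (g @` A).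
Proof. by rewrite image_comp. Qed.

Lemma homeo_imageK f A : (f^-1)%g @` (f @` A) = A.
Proof. by rewrite -homeo_imageM mulVg image_id. Qed.

Lemma homeo_clopen f A : clopen A -> clopen (f @` A).
Proof.
move=> cA; rewrite homeo_imageE; apply: preimage_clopen => //.
exact: homeo_inv_continuous.
Qed.

Lemma local_subgroup_image G A g : local_subgroup G A g -> g @` A = A.
Proof.
move=> [_ gA]; apply: setC_inj; rewrite -homeo_imageC -[RHS]image_id.
exact: eq_imagel.
Qed.

Lemma local_subgroup_conj G K A g :
  is_subgroup G -> is_subgroup K -> G g -> K g ->
  local_subgroup G A `<=` K -> local_subgroup G (g @` A) `<=` K.
Proof.
move=> sG sK Gg Kg AK h [Gh hA].
(* If [h] is supported in [g A], its conjugate by [g] is supported in [A]. *)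
have -> : h = g * (g^-1 * h * g) * g^-1 by rewrite !mulgA mulgV mul1g mulgK.
have Kgh : K (g^-1 * h * g).
  apply: AK; split.
    by apply: is_subgroupM => //; apply: is_subgroupM => //; exact: is_subgroupV.
  move=> x nAx; rewrite /= hA ?homeo_funK// => -[y Ay] /(congr1 (homeo_inv g)).
  by rewrite !homeo_funK => yx; apply: nAx; rewrite -yx.
apply: is_subgroupM => //; last exact: is_subgroupV.
exact: is_subgroupM.
Qed.

(** A bijection commutes with complements, so the image of [U] determines that of [~U]. *)
Lemma stabilizer_collection_pairE G U :
  stabilizer_collection G [set U; ~` U] =
  [set g | G g /\ (g @` U = U \/ g @` U = ~` U)].
Proof.
apply/seteqP; split=> g [Gg gU]; split=> //; first by apply: gU; left.
by case: gU => gU _ [->|->]; rewrite ?homeo_imageC gU ?setCK; [left|right..|left].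
Qed.

Lemma is_subgroup_stabilizer G U :
  is_subgroup G -> is_subgroup (stabilizer G U).
Proof.
move=> sG; apply/is_subgroupP; split.
  by split; [exact: is_subgroup1|exact: image_id].
move=> f g [Gf fU] [Gg gU]; split.
  by apply: is_subgroupM => //; exact: is_subgroupV.
by rewrite homeo_imageM -{1}gU homeo_imageK.
Qed.

Lemma is_subgroup_stabilizer_collection_pair G U :
  is_subgroup G -> is_subgroup (stabilizer_collection G [set U; ~` U]).
Proof.
move=> sG; rewrite stabilizer_collection_pairE; apply/is_subgroupP; split.
  by split; [exact: is_subgroup1|left; exact: image_id].
move=> f g [Gf fU] [Gg gU]; split.
  by apply: is_subgroupM => //; exact: is_subgroupV.
have [gV|gV] : g^-1%g @` U = U \/ g^-1%g @` U = ~` U.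
- case: gU => gU; [left|right]; first by rewrite -{1}gU homeo_imageK.
  by rewrite -{1}[U]setCK -{1}gU -homeo_imageC homeo_imageK.
- by rewrite homeo_imageM gV.
- by rewrite homeo_imageM gV homeo_imageC; case: fU => ->; rewrite ?setCK; auto.
Qed.

(** * Property E as a source of inclusions into a subgroup *)

Lemma property_E_sub G K A B :
  property_E G -> is_subgroup K -> clopen A -> clopen B -> A `&` B !=set0 ->
  local_subgroup G A `<=` K -> local_subgroup G B `<=` K ->
  local_subgroup G (A `|` B) `<=` K.
Proof.
move=> EG sK cA cB AB0 AK BK; rewrite -EG//; apply: generated_sub => //.
by move=> g [/AK|/BK].
Qed.

Lemma property_E_cover G K A B :
  property_E G -> is_subgroup K -> clopen A -> clopen B -> A `&` B !=set0 ->
  A `|` B = setT -> local_subgroup G A `<=` K -> local_subgroup G B `<=` K ->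
  G `<=` K.
Proof.
move=> EG sK cA cB AB0 ABT AK BK g Gg.
have := property_E_sub G K A B EG sK cA cB AB0 AK BK.
by rewrite ABT; apply; split=> // x /(_ I).
Qed.

(** Property E first joins [V] to [U], which it meets, and then joins their union to [~U], which it
    meets at a point of [V] outside [U]. *)
Lemma local_subgroups_cover G K U V :
  property_E G -> is_subgroup K -> clopen U -> clopen V ->
  V `&` U !=set0 -> V `&` ~` U !=set0 ->
  local_subgroup G U `<=` K -> local_subgroup G (~` U) `<=` K ->
  local_subgroup G V `<=` K -> G `<=` K.
Proof.
move=> EG sK cU cV VU [x [Vx nUx]] UK UCK VK.
apply: (property_E_cover G K (V `|` U) (~` U)) => //.
- exact: clopenU.
- exact: clopenC.
- by exists x; split=> //; left.
- by rewrite -setUA setUv setUT.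
- exact: property_E_sub.
Qed.

(** A set that misses one of [U], [~U] lies in the other. If this happens to both [V] and [~V], the
    four combinations give, in the order of the proof, [U] empty, [V = ~U], [V = U], and [U] the
    whole space. *)
Lemma partition_crossing U V :
  V <> set0 -> V <> setT -> V <> U -> V <> ~` U ->
  U <> set0 -> U <> setT ->
  (V `&` U !=set0 /\ V `&` ~` U !=set0) \/
  (~` V `&` U !=set0 /\ ~` V `&` ~` U !=set0).
Proof.
move=> V0 VT VU VUC U0 UT; apply: contrapT => /not_orP[/not_andP nV /not_andP nVC].
have sub A B : ~ (A `&` B !=set0) -> A `<=` ~` B.
  by move=> nAB x Ax Bx; apply: nAB; exists x.
case: nV => /sub VB; case: nVC => /sub VCB.
- apply: U0; apply/seteqP; split=> // x Ux.
  by have [/VB|/VCB] := EM (V x).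
- apply: VUC; apply/seteqP; split=> // x nUx.
  by apply: contrapT => /VCB; rewrite setCK.
- apply: VU; rewrite setCK in VB; apply/seteqP; split=> // x Ux.
  by apply: contrapT => /VCB.
- apply: UT; rewrite !setCK in VB VCB; apply/seteqP; split=> // x _.
  by have [/VB|/VCB] := EM (V x).
Qed.

(** The Cantor space is perfect, so the open copy of [U] in it has two distinct points, and
    zero-dimensionality separates them by a clopen set. *)
Lemma cantor_set_clopen_split U :
  cantor_set X -> clopen U -> U <> set0 ->
  exists A, [/\ clopen A, A `<=` U, A !=set0 & U `\` A !=set0].
Proof.
move=> [f [g [cf cg fK gK]]] cU /eqP/set0P[x Ux].
have [||y [z [Uy Uz yz]]] := (iffLR perfectTP_ex) cantor_perfect (g @^-1` U).
- by case: (preimage_clopen cU cg).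
- by exists (f x); rewrite /= fK.
have [B [cB By nBz]] := cantor_zero_dimensional yz.
exists (U `&` f @^-1` B); split.
- by apply: clopenI => //; exact: preimage_clopen.
- exact: subIsetl.
- by exists (g y); split; rewrite //= gK.
- by exists (g z); split=> // -[_]; rewrite /= gK.
Qed.

Lemma stabilizer_collection_proper G U :
  cantor_set X -> is_subgroup G -> acts_minimally G -> property_E G ->
  clopen U -> U <> set0 -> U <> setT ->
  ~ G `<=` stabilizer_collection G [set U; ~` U].
Proof.
rewrite stabilizer_collection_pairE => CX sG mG EG cU U0 UT GH.
have [A [cA AU [a Aa] [b [Ub nAb]]]] := cantor_set_clopen_split U CX cU U0.
(* Then [U] is closed and invariant, so minimality makes it empty or everything. *)
suff GU : G `<=` stabilizer G U.
  have [//|g /GU[_ ->] //|//|//] := mG U.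
  by case: cU.
apply: (property_E_cover G _ U (~` U `|` A)) => //.
- exact: is_subgroup_stabilizer.
- by apply: clopenU => //; exact: clopenC.
- by exists a; split; [exact: AU|right].
- by rewrite setUA setUv setTU.
- by move=> h lh; split; [case: lh|exact: local_subgroup_image lh].
(* The point [b] of [U] lies outside [~U] and [A], so [h] fixes it and cannot swap [U] with [~U]. *)
- move=> h [Gh hA]; split=> //; have [_ [//|hU]] := GH h Gh.
  have : (h @` U) (h b) by exists b.
  by rewrite hU hA// => -[].
Qed.

Lemma maximal_stabilizer_pair G U :
  cantor_set X -> is_subgroup G -> acts_minimally G -> property_E G ->
  clopen U -> U <> set0 -> U <> setT ->
  maximal_subgroup G (stabilizer_collection G [set U; ~` U]).
Proof.
move=> CX sG mG EG cU U0 UT; split.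
- exact: is_subgroup_stabilizer_collection_pair.
- by split; [move=> g []|exact: stabilizer_collection_proper].
move=> [K [sK [HK nKH] [KG nGK]]]; apply: nGK.
have /existsNP[g /not_implyP[Kg nHg]] := nKH; have Gg := KG _ Kg.
rewrite stabilizer_collection_pairE in HK nHg.
have UK : local_subgroup G U `<=` K.
  move=> h lh; apply: HK; split; first by case: lh.
  by left; exact: local_subgroup_image lh.
have UCK : local_subgroup G (~` U) `<=` K.
  move=> h lh; apply: HK; split; first by case: lh.
  (* [h] preserves [~U] as a set, hence also [U]. *)
  by left; apply: setC_inj; rewrite -homeo_imageC; exact: local_subgroup_image lh.
have gK A : local_subgroup G A `<=` K -> local_subgroup G (g @` A) `<=` K.
  exact: local_subgroup_conj.
have inj A : g @` U = A -> U = (g^-1)%g @` A by move<-; rewrite homeo_imageK.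
(* The crossing set is [g U] or its complement [g (~U)]; either way its local subgroup is conjugate
   by [g] to one already in [K]. *)
case: (partition_crossing U (g @` U)) => //.
- by move/inj; rewrite image_set0.
- by move/inj; rewrite homeo_imageE.
- by move=> gU; apply: nHg; split=> //; left.
- by move=> gU; apply: nHg; split=> //; right.
- move=> [gU gUC]; apply: (local_subgroups_cover G K U (g @` U)) => //.
    exact: homeo_clopen.
  exact: gK.
- rewrite -homeo_imageC => -[gU gUC].
  apply: (local_subgroups_cover G K U (g @` (~` U))) => //.
    exact/homeo_clopen/clopenC.
  exact: gK.
Qed.

End Homeomorphisms.

Theorem theorem1p4 (X : topologicalType) (G : set (homeo X)) (U : set X) :
  cantor_set X ->
  is_subgroup G -> ample G -> acts_minimally G -> property_E G ->
  clopen U -> U <> set0 -> U <> setT ->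
  [/\ maximal_subgroup G (stabilizer_collection G [set U; ~` U]),
      ~ (exists2 g : homeo X, G g & g @` U = ~` U) ->
        stabilizer G U = stabilizer_collection G [set U; ~` U]
    & (exists2 g : homeo X, G g & g @` U = ~` U) ->
        subgroup_of_index 2 (stabilizer_collection G [set U; ~` U])
                            (stabilizer G U)].
Proof.
move=> CX sG _ mG EG cU U0 UT; split.
- exact: maximal_stabilizer_pair.
- move=> nswap; rewrite stabilizer_collection_pairE.
  apply/seteqP; split=> g [Gg gU]; split=> //; first by left.
  by case: gU => // gU; case: nswap; exists g.
move=> [g Gg gU]; have gUC : (g^-1)%g @` (~` U) = U by rewrite -gU homeo_imageK.
apply: (subgroup_of_index2 _ _ g).
- exact: is_subgroup_stabilizer_collection_pair.
- exact: is_subgroup_stabilizer.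
- by rewrite stabilizer_collection_pairE => h [Gh hU]; split=> //; left.
- by rewrite stabilizer_collection_pairE; split=> //; right.
(* Were the swapping [g] to preserve [U], then [~U = U], which forces [U] to be everything. *)
- move=> [_]; rewrite gU => /seteqP[UCU _]; apply: UT.
  by apply/seteqP; split=> // x _; apply: contrapT => /[dup] /UCU.
(* If [h] swaps the two pieces, [g^-1 * h] sends [U] to [~U] and back. *)
rewrite stabilizer_collection_pairE => h [Gh [hU|hU]]; [by left|right].
split; last by rewrite homeo_imageM hU.
by apply: is_subgroupM => //; exact: is_subgroupV.
Qed.
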